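(* Let $\mathcal{A}$ be a pattern of order $n$ (either a nonzero pattern or a sign pattern), and suppose $A\in\mathcal{A}$ is a real matrix with refined inertia $\operatorname{ri}(A)=(0,0,c_1,c_2)$ for some $c_1\geq 2$ that allows a full-rank Jacobian. Let $u\neq v$ be vertices such that $(u,v)$ is an arc of $D(\mathcal{A})$ lying on some composite $n$-cycle of $D(\mathcal{A})$, and such that $D(\mathcal{A})$ has a loop at $u$. Suppose that (i) every (simple) cycle of $D(\mathcal{A})$ that contains the vertex $u$ also contains the loop $(u,u)$ or the arc $(u,v)$; and (ii) the sum of the weights in $A$ of the composite $n$-cycles of $A$ that use the arc $(u,v)$ is nonzero. If $\mathcal{B}$ is a triangle extension of $\mathcal{A}$ at $(u,v)$ (a signed triangle extension in case $\mathcal{A}$ is a sign pattern), then every superpattern of $\mathcal{B}$ is inertially arbitrary.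
   Context: A nonzero pattern is a square matrix with entries in $\{0,*\}$; a real matrix $A=[a_{ij}]$ has nonzero pattern $\mathcal{A}$ if $a_{ij}=0$ exactly when $\mathcal{A}_{ij}=0$. A sign pattern has entries in $\{0,+,-\}$; $A$ has sign pattern $\mathcal{A}$ if $a_{ij}=0$ when $\mathcal{A}_{ij}=0$, $a_{ij}>0$ when $\mathcal{A}_{ij}=+$, $a_{ij}<0$ when $\mathcal{A}_{ij}=-$. Write $A\in\mathcal{A}$. The digraph $D(\mathcal{A})$ has vertices $\{1,\dots,n\}$ and an arc $(i,j)$ exactly when $\mathcal{A}_{ij}\neq0$ (arc $(i,i)$ is a loop). A (simple) $k$-cycle of $A$ is a nonzero product $a_{i_1i_2}\cdots a_{i_ki_1}$ with distinct indices, its weight being this product; a composite $k$-cycle is a product of vertex-disjoint simple cycles covering exactly $k$ vertices, with weight the product of their weights. $A$ allows a full-rank Jacobian: if $A$ has $m$ nonzero entries in positions $(i_1,j_1),\dots,(i_m,j_m)$, let $X$ be obtained from $A$ by replacing the entry at $(i_k,j_k)$ by an indeterminate $x_k$, write $\det(zI-X)=z^n+f_1z^{n-1}+\cdots+f_n$, and let $J_{ij}=\partial f_i/\partial x_j$; $A$ allows a full-rank Jacobian if $J$ evaluated at the entries of $A$ has rank $n$. The refined inertia of a real matrix $A$ is $\operatorname{ri}(A)=(a,b,c_1,c_2)$ where $a$ (resp. $b$) is the number of eigenvalues with positive (resp. negative) real part, $c_1$ the number of zero eigenvalues, and $c_2$ the number of nonzero purely imaginary eigenvalues (counted with multiplicity).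 The inertia is $(a,b,c_1+c_2)$. A pattern of order $n$ is inertially arbitrary if for every triple of nonnegative integers $(a,b,c)$ with $a+b+c=n$ there is a matrix in the pattern with inertia $(a,b,c)$. A pattern $\mathcal{C}$ is a superpattern of $\mathcal{B}$ if $\mathcal{B}_{ij}\neq0$ implies $\mathcal{C}_{ij}=\mathcal{B}_{ij}$. Triangle extension: if $G$ is a digraph with an arc $(u,v)$, $u\neq v$, and a loop at $u$, the triangle extension of $G$ at $(u,v)$ is obtained by adding a new vertex $w$, deleting the loop at $u$, adding a loop at $w$, and adding arcs $(u,w)$ and $(w,v)$. A pattern $\mathcal{B}$ of order $n+1$ is a triangle extension of $\mathcal{A}$ at $(u,v)$ if $D(\mathcal{B})$ is the triangle extension of $D(\mathcal{A})$ at $(u,v)$ (entries on inherited arcs as in $\mathcal{A}$, loop at $w$ carrying the entry of the former loop at $u$). For sign patterns, it is a signed triangle extension if moreover $\operatorname{sgn}(\mathcal{B}_{u,w})\operatorname{sgn}(\mathcal{B}_{w,v})=\operatorname{sgn}(\mathcal{A}_{u,u})\operatorname{sgn}(\mathcal{A}_{u,v})$.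
   Formalization: In (ii) the weight of a simple cycle of length l is taken with the sign (-1)^(l-1), so the sum is the part of det A whose terms use the arc (u,v); with unsigned products as weights the statement fails for some reducible sign patterns. *)

(* Defs.v *)
From HB Require Import structures.
From mathcomp Require Import all_boot all_order all_fingroup all_algebra.
From mathcomp Require Import reals.
From mathcomp Require Import complex mpoly.

Set Implicit Arguments.
Unset Strict Implicit.
Unset Printing Implicit Defensive.

Import Order.TTheory GRing.Theory Num.Theory.
Local Open Scope ring_scope.

Variant pattern_kind := NonzeroPattern | SignPattern.

Variant sign := SZero | SPlus | SMinus.

(* In a nonzero pattern, [true] is the entry [*] and [false] the entry [0]. *)
Definition entry (k : pattern_kind) : Type :=
  match k with NonzeroPattern => bool | SignPattern => sign end.

Definition entry0 (k : pattern_kind) : entry k :=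
  match k with NonzeroPattern => false | SignPattern => SZero end.

Definition entry_nz (k : pattern_kind) : entry k -> bool :=
  match k with
  | NonzeroPattern => fun e => e
  | SignPattern => fun e => if e is SZero then false else true
  end.

Definition entry_holds (R : realType) (k : pattern_kind) : entry k -> R -> bool :=
  match k with
  | NonzeroPattern => fun e x => (x == 0) == ~~ e
  | SignPattern => fun e x =>
      match e with SZero => x == 0 | SPlus => 0 < x | SMinus => x < 0 end
  end.

Definition pattern (k : pattern_kind) (n : nat) : Type := 'M[entry k]_n.

Definition in_pattern (R : realType) (k : pattern_kind) (n : nat)
    (P : pattern k n) (A : 'M[R]_n) : Prop :=
  forall i j, entry_holds (P i j) (A i j).

Definition superpattern (k : pattern_kind) (n : nat) (C B : pattern k n) : Prop :=
  forall i j, entry_nz (B i j) -> C i j = B i j.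

Definition darc (k : pattern_kind) (n : nat) (P : pattern k n) : rel 'I_n :=
  fun i j => entry_nz (P i j).

(* [c] lists the vertices of a simple cycle in order; [next c i] is the head of
   the arc of the cycle leaving [i] (the loop at [i] is [c = [:: i]]). *)
Definition simple_cycle (k : pattern_kind) (n : nat) (P : pattern k n)
    (c : seq 'I_n) : Prop :=
  c <> [::] /\ ucycle (darc P) c.

Definition cycle_uses (n : nat) (c : seq 'I_n) (i j : 'I_n) : Prop :=
  i \in c /\ next c i = j.

(* A family of vertex-disjoint simple cycles covering all [n] vertices is the
   permutation [s] sending each vertex to its successor; the simple cycles of
   the family are the orbits of [s], and its arcs are the pairs [(i, s i)]. *)
Definition composite_cycle (k : pattern_kind) (n : nat) (P : pattern k n)
    (s : {perm 'I_n}) : Prop :=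
  forall i, darc P i (s i).

Definition composite_cycle_of (R : realType) (n : nat) (A : 'M[R]_n)
    (s : {perm 'I_n}) : bool :=
  [forall i, A i (s i) != 0].

(* A cycle of length l is counted with the sign (-1)^(l-1) it has in the
   determinant.  This sign matters: if the weights are taken to be the bare
   products of entries, the theorem fails for some reducible sign patterns. *)
Definition cycle_weight (R : realType) (n : nat) (A : 'M[R]_n)
    (s : {perm 'I_n}) (c : {set 'I_n}) : R :=
  (-1) ^+ #|c|.-1 * \prod_(i in c) A i (s i).

Definition composite_weight (R : realType) (n : nat) (A : 'M[R]_n)
    (s : {perm 'I_n}) : R :=
  \prod_(c in porbits s) cycle_weight A s c.

Definition composite_weight_through (R : realType) (n : nat) (A : 'M[R]_n)
    (u v : 'I_n) : R :=
  \sum_(s : {perm 'I_n} | composite_cycle_of A s && (s u == v))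
     composite_weight A s.

Section Jacobian.
Variables (R : realType) (n : nat) (A : 'M[R]_n).

Definition nz_positions : {set 'I_n * 'I_n} := [set p | A p.1 p.2 != 0].

Definition nz_position (k : 'I_#|nz_positions|) : 'I_n * 'I_n := enum_val k.

(* The indeterminate ['X_k] at the k-th nonzero position, 0 elsewhere. *)
Definition indet_mx : 'M[{mpoly R[#|nz_positions|]}]_n :=
  \matrix_(i, j) \sum_(k < #|nz_positions| | nz_position k == (i, j)) 'X_k.

(* [char_coef i] is the coefficient of z^(n-i) in det(zI - X). *)
Definition char_coef (i : nat) : {mpoly R[#|nz_positions|]} :=
  (char_poly indet_mx)`_(n - i).

Definition char_jacobian : 'M[R]_(n, #|nz_positions|) :=
  \matrix_(i, k)
    (mderiv k (char_coef i.+1)).@[fun l => A (nz_position l).1 (nz_position l).2].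

Definition full_rank_jacobian : Prop := \rank char_jacobian = n.
End Jacobian.

Section Inertia.
Variables (R : realType) (n : nat) (A : 'M[R]_n).

(* The complex eigenvalues, listed with algebraic multiplicity. *)
Definition eigenvalues : seq (complex R) :=
  sval (closed_field_poly_normal (map_poly (real_complex R) (char_poly A))).

Definition refined_inertia : nat * nat * nat * nat :=
  (count (fun z : complex R => 0 < complex.Re z) eigenvalues,
   count (fun z : complex R => complex.Re z < 0) eigenvalues,
   count (fun z : complex R => z == 0) eigenvalues,
   count (fun z : complex R => (z != 0) && (complex.Re z == 0)) eigenvalues).

Definition inertia : nat * nat * nat :=
  let: (a, b, c1, c2) := refined_inertia in (a, b, (c1 + c2)%N).
End Inertia.

Definition inertially_arbitrary (R : realType) (k : pattern_kind) (n : nat)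
    (P : pattern k n) : Prop :=
  forall a b c : nat, (a + b + c)%N = n ->
    exists A : 'M[R]_n, in_pattern P A /\ inertia A = (a, b, c).

(* The new vertex w is the last one, [ord_max]; an old vertex i is
   [lift ord_max i], which has the same value as i. *)
Definition triangle_extension (k : pattern_kind) (n : nat)
    (P : pattern k n) (B : pattern k n.+1) (u v : 'I_n) : Prop :=
  [/\ forall i j, B (lift ord_max i) (lift ord_max j) =
        if (i == u) && (j == u) then entry0 k else P i j,
      B ord_max ord_max = P u u,
      forall i, darc B (lift ord_max i) ord_max = (i == u) &
      forall j, darc B ord_max (lift ord_max j) = (j == v)].

Definition sgn_of_sign (e : sign) : int :=
  match e with SZero => 0 | SPlus => 1 | SMinus => -1 end.

Definition same_sgn_product (k : pattern_kind) : forall a b c d : entry k, Prop :=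
  match k with
  | NonzeroPattern => fun _ _ _ _ => True
  | SignPattern => fun a b c d =>
      sgn_of_sign a * sgn_of_sign b = sgn_of_sign c * sgn_of_sign d
  end.

(* A triangle extension for nonzero patterns, a signed triangle extension for
   sign patterns. *)
Definition kind_triangle_extension (k : pattern_kind) (n : nat)
    (P : pattern k n) (B : pattern k n.+1) (u v : 'I_n) : Prop :=
  triangle_extension P B u v /\
  same_sgn_product (B (lift ord_max u) ord_max) (B ord_max (lift ord_max v))
                   (P u u) (P u v).

(* Main.v *)
Require Import Defs.
From HB Require Import structures.
From mathcomp Require Import all_boot all_order all_fingroup all_algebra.
From mathcomp Require Import reals.
From mathcomp Require Import complex mpoly.
From mathcomp Require Import boolp classical_sets functions topology normedtype sequences.
From mathcomp Require Import interval_inference.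
From mathcomp Require Import zify ring lra.

Set Implicit Arguments.
Unset Strict Implicit.
Unset Printing Implicit Defensive.

Import Order.TTheory GRing.Theory Num.Theory.
Import numFieldNormedType.Exports.
Local Open Scope ring_scope.

(* Write [w] for the new vertex, and give [u -> w], [w -> v] weights [p], [q].
   By (i), expanding along row [u] and bordering shows that the characteristic
   polynomial of the extended matrix is [z det(zI - X) + (x_uu x_uv - p q) h(z)],
   with [h] the [(u, v)] cofactor of [zI - X].  Take [p = 1] or [-1] and
   [q = p (x_uu x_uv - d)]: the Jacobian of [A] controls the coefficients of
   [z^1, ..., z^n] and [d] the constant one, because [h(0) <> 0] by (ii).  So by
   the implicit function theorem every superpattern of the extension realizes
   all polynomials close to [z det(zI - A) = z^(c1+1) prod (z^2 + b^2)].  Moving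
   the zero roots along the real axis and the pairs [+-ib] horizontally gives
   every inertia: since [c1 + 1 >= 3], the pairs can always be distributed
   among the three classes. *)

(** * Strict differentiability with a parameter *)

Section StrictDifferentiability.
Variables (R : realType) (V : normedModType R).
Implicit Types (f g : V -> R -> R) (L : V -> R).

Definition param_cont f :=
  forall e, 0 < e -> exists2 r, 0 < r &
    forall y t, `|y| <= r -> `|t| <= r -> `|f y t - f 0 0| <= e.

(** Differentiability in [y] at the origin in two-point form, with one radius serving all small [t];
    in [t] only continuity at the origin is asked. Comparing two arbitrary points [y], [y'] is what
    later makes the Newton map a contraction. *)
Definition strict_diff f L :=
  [/\ forall a v, L (a *: v) = a * L v,
      exists2 c, 0 <= c & forall v, `|L v| <= c * `|v|,
      param_cont f &
      forall e, 0 < e -> exists2 r, 0 < r &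
        forall y y' t, `|y| <= r -> `|y'| <= r -> `|t| <= r ->
          `|f y t - f y' t - L (y - y')| <= e * `|y - y'|].

Lemma strict_diff_eq f g L L' :
  (forall y t, f y t = g y t) -> (forall y, L y = L' y) ->
  strict_diff f L -> strict_diff g L'.
Proof.
move=> fg LL'.
have -> : g = f by apply/funext => y; apply/funext => t; rewrite fg.
by have -> : L' = L by apply/funext => y; rewrite LL'.
Qed.

Lemma strict_diff_param_fun (h : R -> R) :
  (forall e, 0 < e -> exists2 r, 0 < r &
    forall t, `|t| <= r -> `|h t - h 0| <= e) ->
  strict_diff (fun _ t => h t) (fun=> 0).
Proof.
move=> hc; split.
- by move=> a v; rewrite mulr0.
- by exists 0 => // v; rewrite normr0 mul0r.
- by move=> e /hc[r r0 hr]; exists r => // y t _; apply: hr.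
- move=> e e0; exists 1 => // y y' t _ _ _.
  by rewrite subr0 subrr normr0 mulr_ge0 // ltW.
Qed.

Lemma strict_diff_cst (c : R) : strict_diff (fun _ _ => c) (fun=> 0).
Proof.
apply: (strict_diff_param_fun (h := fun=> c)) => e e0; exists 1 => // t _.
by rewrite subrr normr0 ltW.
Qed.

Lemma strict_diff_param : strict_diff (fun _ t => t) (fun=> 0).
Proof.
apply: (strict_diff_param_fun (h := id)) => e e0; exists e => // t.
by rewrite subr0.
Qed.

Lemma strict_diff_linear L :
  (forall v w, L (v - w) = L v - L w) -> (forall a v, L (a *: v) = a * L v) ->
  (exists2 c, 0 <= c & forall v, `|L v| <= c * `|v|) ->
  strict_diff (fun y _ => L y) L.
Proof.
move=> LB LZ [c c0 Lc]; split=> //.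
- by exists c.
- move=> e e0; exists (e / (c + 1)); first by rewrite divr_gt0 // ltr_wpDl.
  move=> y t ye _; rewrite -LB subr0; apply: le_trans (Lc y) _.
  have c1 : 0 < c + 1 by rewrite ltr_wpDl.
  apply: (@le_trans _ _ ((c + 1) * `|y|)).
    by rewrite ler_wpM2r // lerDl.
  by rewrite mulrC -ler_pdivlMr.
- move=> e e0; exists 1 => // y y' t _ _ _.
  by rewrite LB subrr normr0 mulr_ge0 // ltW.
Qed.

Lemma strict_diffD f g L L' : strict_diff f L -> strict_diff g L' ->
  strict_diff (fun y t => f y t + g y t) (fun y => L y + L' y).
Proof.
move=> [fZ [cf cf0 fc] ff fd] [gZ [cg cg0 gc] gg gd]; split.
- by move=> a v; rewrite fZ gZ mulrDr.
- exists (cf + cg); first exact: addr_ge0.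
  by move=> v; rewrite mulrDl (le_trans (ler_normD _ _)) // lerD.
- move=> e e0; have e2 : 0 < e / 2 by rewrite divr_gt0.
  have [r r0 hr] := ff _ e2; have [r' r0' hr'] := gg _ e2.
  exists (Num.min r r'); first by rewrite lt_min r0.
  move=> y t; rewrite !le_min => /andP[y1 y2] /andP[t1 t2].
  have -> : f y t + g y t - (f 0 0 + g 0 0) =
            (f y t - f 0 0) + (g y t - g 0 0) by ring.
  by rewrite (splitr e) (le_trans (ler_normD _ _)) // lerD ?hr ?hr'.
- move=> e e0; have e2 : 0 < e / 2 by rewrite divr_gt0.
  have [r r0 hr] := fd _ e2; have [r' r0' hr'] := gd _ e2.
  exists (Num.min r r'); first by rewrite lt_min r0.
  move=> y y' t; rewrite !le_min => /andP[y1 y2] /andP[z1 z2] /andP[t1 t2].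
  have -> : f y t + g y t - (f y' t + g y' t) - (L (y - y') + L' (y - y')) =
    (f y t - f y' t - L (y - y')) + (g y t - g y' t - L' (y - y')) by ring.
  by rewrite (splitr e) mulrDl (le_trans (ler_normD _ _)) // lerD ?hr ?hr'.
Qed.

Lemma strict_diffM f g L L' : strict_diff f L -> strict_diff g L' ->
  strict_diff (fun y t => f y t * g y t) (fun y => f 0 0 * L' y + g 0 0 * L y).
Proof.
move=> [fZ [cf cf0 fc] ff fd] [gZ [cg cg0 gc] gg gd].
(* [K] dominates the sum of the constants that multiply the small quantity [q] in the error terms,
   so [q * K <= e] suffices; [q <= 1] bounds [f] and [g] near the origin by their values there plus
   1. *)
pose K := (`|f 0 0| + 1) + (`|g 0 0| + 1) + cf + cg.
have f1 : 0 <= `|f 0 0| by [].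
have g1 : 0 <= `|g 0 0| by [].
have K0 : 0 < K by rewrite /K; lra.
have small e : 0 < e -> exists2 q, 0 < q & q <= 1 /\ q * K <= e.
  move=> e0; exists (Num.min 1 (e / K)); first by rewrite lt_min ltr01 divr_gt0.
  split; first by rewrite ge_min lexx.
  by rewrite -ler_pdivlMr // ge_min lexx orbT.
split.
- by move=> a v; rewrite fZ gZ; ring.
- exists (`|f 0 0| * cg + `|g 0 0| * cf).
    by rewrite addr_ge0 // mulr_ge0.
  move=> v; rewrite mulrDl (le_trans (ler_normD _ _)) // !normrM.
  by rewrite -!mulrA lerD // ler_wpM2l.
- move=> e /small[q q0 [q1 qK]].
  have [r r0 hr] := ff _ q0; have [r' r0' hr'] := gg _ q0.
  exists (Num.min r r'); first by rewrite lt_min r0.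
  move=> y t; rewrite !le_min => /andP[y1 y2] /andP[t1 t2].
  have h1 := hr _ _ y1 t1; have h2 := hr' _ _ y2 t2.
  have -> : f y t * g y t - f 0 0 * g 0 0 =
    (f y t - f 0 0) * g y t + f 0 0 * (g y t - g 0 0) by ring.
  have gb : `|g y t| <= `|g 0 0| + 1.
    rewrite -[g y t](subrK (g 0 0)) addrC (le_trans (ler_normD _ _)) // lerD2l.
    exact: le_trans h2 q1.
  apply: le_trans qK; apply: (@le_trans _ _ (q * (`|g 0 0| + 1) + `|f 0 0| * q)).
    by rewrite (le_trans (ler_normD _ _)) // !normrM lerD // ?ler_pM // ler_wpM2l.
  rewrite [`|f 0 0| * q]mulrC -mulrDr ler_pM2l // /K; lra.
- move=> e /small[q q0 [q1 qK]].
  have [r1 r10 hr1] := ff _ q0; have [r2 r20 hr2] := gg _ q0.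
  have [r3 r30 hr3] := fd _ q0; have [r4 r40 hr4] := gd _ q0.
  exists (Num.min (Num.min r1 r2) (Num.min r3 r4)); first by rewrite !lt_min r10 r20 r30.
  move=> y y' t; rewrite !le_min => /andP[/andP[y1 y2] /andP[y3 y4]].
  move=> /andP[/andP[z1 z2] /andP[z3 z4]] /andP[/andP[t1 t2] /andP[t3 t4]].
  have h1 := hr1 _ _ z1 t1; have h2 := hr2 _ _ y2 t2.
  have h3 := hr3 _ _ _ y3 z3 t3; have h4 := hr4 _ _ _ y4 z4 t4.
  (* Each of the four summands has one factor controlled by [q]: a linearization error or a
     deviation from the value at the origin. *)
  have -> : f y t * g y t - f y' t * g y' t -
      (f 0 0 * L' (y - y') + g 0 0 * L (y - y')) =
    (f y t - f y' t - L (y - y')) * g y t + L (y - y') * (g y t - g 0 0) +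
    (f y' t * (g y t - g y' t - L' (y - y')) + (f y' t - f 0 0) * L' (y - y')).
    by ring.
  have gb : `|g y t| <= `|g 0 0| + 1.
    rewrite -[g y t](subrK (g 0 0)) addrC (le_trans (ler_normD _ _)) // lerD2l.
    exact: le_trans h2 q1.
  have fb : `|f y' t| <= `|f 0 0| + 1.
    rewrite -[f y' t](subrK (f 0 0)) addrC (le_trans (ler_normD _ _)) // lerD2l.
    exact: le_trans h1 q1.
  set d := y - y' in h3 h4 *.
  have d0 : 0 <= `|d| by [].
  apply: (@le_trans _ _ (q * K * `|d|)); last by rewrite ler_wpM2r.
  have -> : q * K * `|d| = ((q * `|d|) * (`|g 0 0| + 1) + (cf * `|d|) * q) +
     ((`|f 0 0| + 1) * (q * `|d|) + q * (cg * `|d|)) by rewrite /K; ring.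
  apply: le_trans (ler_normD _ _) (lerD _ _).
    by apply: le_trans (ler_normD _ _) (lerD _ _); rewrite normrM ler_pM.
  by apply: le_trans (ler_normD _ _) (lerD _ _); rewrite normrM ler_pM.
Qed.

(* Both linear parts are limits of the same difference quotients. *)
Lemma strict_diff_unique f L L' : strict_diff f L ->
  strict_diff (fun y _ => f y 0) L' -> forall v, L v = L' v.
Proof.
move=> [fZ _ _ fd] [gZ _ _ gd] v.
have [->|v0] := eqVneq v 0.
  by rewrite -(scale0r 0) fZ gZ !mul0r.
apply/eqP; rewrite -subr_eq0 -normr_le0; apply/ler_addgt0Pr => e e0.
rewrite add0r.
have nv : 0 < `|v| by rewrite normr_gt0.
(* Testing along [a *: v], of norm [min r1 r2], costs an error of [a * e / 2] for each of [L] and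
   [L']; dividing by [a] leaves [e]. *)
pose e' := e / (2 * `|v|).
have e'0 : 0 < e' by rewrite divr_gt0 // mulr_gt0.
have [r1 r10 h1] := fd _ e'0; have [r2 r20 h2] := gd _ e'0.
pose a := Num.min r1 r2 / `|v|.
have a0 : 0 < a by rewrite divr_gt0 // lt_min r10.
have nav : `|a *: v| = Num.min r1 r2.
  by rewrite normrZ gtr0_norm // /a divfK // gt_eqF.
have {}h1 := h1 (a *: v) 0 0; have {}h2 := h2 (a *: v) 0 0.
rewrite nav normr0 subr0 nav fZ in h1.
rewrite nav normr0 subr0 nav gZ in h2.
have {}h1 : `|f (a *: v) 0 - f 0 0 - a * L v| <= e' * Num.min r1 r2.
  by apply: h1; rewrite ?normr0 ?ge_min ?lexx ?(ltW r10).
have {}h2 : `|f (a *: v) 0 - f 0 0 - a * L' v| <= e' * Num.min r1 r2.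
  by apply: h2; rewrite ?normr0 ?ge_min ?lexx ?orbT ?(ltW r20).
rewrite -(ler_pM2l a0) -{1}(gtr0_norm a0) -normrM.
have -> : a * (L v - L' v) = (f (a *: v) 0 - f 0 0 - a * L' v) -
    (f (a *: v) 0 - f 0 0 - a * L v) by ring.
apply: le_trans (ler_normB _ _) _; apply: le_trans (lerD h2 h1) _.
rewrite le_eqVlt; apply/orP; left; apply/eqP; rewrite /a /e'.
by field; rewrite gt_eqF.
Qed.

(** Hides the differential: for the full map only its existence is tracked, and [strict_diff_unique]
    reads it off the slice [t = 0]. *)
Definition strict_diffable f := exists L, strict_diff f L.

Lemma strict_diffable_eq f g : (forall y t, f y t = g y t) ->
  strict_diffable f -> strict_diffable g.
Proof. by move=> fg [L h]; exists L; apply: strict_diff_eq h. Qed.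

Lemma strict_diffable_cst c : strict_diffable (fun _ _ => c).
Proof. by exists (fun=> 0); apply: strict_diff_cst. Qed.

Lemma strict_diffable_sum (I : Type) (s : seq I) (Q : pred I)
    (F : I -> V -> R -> R) : (forall i, strict_diffable (F i)) ->
  strict_diffable (fun y t => \sum_(i <- s | Q i) F i y t).
Proof.
move=> h; elim: s => [|a s [L hL]].
  by apply: strict_diffable_eq (strict_diffable_cst 0) => y t; rewrite big_nil.
case Qa: (Q a); last first.
  by exists L; apply: strict_diff_eq hL => // y t; rewrite big_cons Qa.
have [La ha] := h a; exists (fun y => La y + L y).
by apply: strict_diff_eq (strict_diffD ha hL) => // y t; rewrite big_cons Qa.
Qed.

Definition poly_strict_diffable (F : V -> R -> {poly R}) :=
  forall i, strict_diffable (fun y t => (F y t)`_i).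

Lemma poly_strict_diffable_eq F G : (forall y t, F y t = G y t) ->
  poly_strict_diffable F -> poly_strict_diffable G.
Proof. by move=> FG h i; apply: strict_diffable_eq (h i) => y t; rewrite FG. Qed.

Lemma poly_strict_diffable_cst p : poly_strict_diffable (fun _ _ => p).
Proof. by move=> i; apply: strict_diffable_cst. Qed.

Lemma poly_strict_diffableC f : strict_diffable f ->
  poly_strict_diffable (fun y t => (f y t)%:P).
Proof.
move=> h [|i]; first by apply: strict_diffable_eq h => y t; rewrite coefC.
by apply: strict_diffable_eq (strict_diffable_cst 0) => y t; rewrite coefC.
Qed.

Lemma poly_strict_diffableD F G : poly_strict_diffable F ->
  poly_strict_diffable G -> poly_strict_diffable (fun y t => F y t + G y t).
Proof.
move=> hF hG i; have [L hL] := hF i; have [L' hL'] := hG i.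
exists (fun y => L y + L' y).
by apply: strict_diff_eq (strict_diffD hL hL') => // y t; rewrite coefD.
Qed.

Lemma strict_diffableM f g : strict_diffable f -> strict_diffable g ->
  strict_diffable (fun y t => f y t * g y t).
Proof. by move=> [L h] [L' h']; eexists; apply: strict_diffM h h'. Qed.

Lemma poly_strict_diffableM F G : poly_strict_diffable F ->
  poly_strict_diffable G -> poly_strict_diffable (fun y t => F y t * G y t).
Proof.
move=> hF hG i; apply: (@strict_diffable_eq
   (fun y t => \sum_(j <- enum 'I_i.+1) (F y t)`_j * (G y t)`_(i - j))).
  by move=> y t; rewrite coefM big_enum.
by apply: strict_diffable_sum => j; apply: strict_diffableM.
Qed.

Lemma poly_strict_diffable_sum (I : Type) (s : seq I) (Q : pred I)
    (F : I -> V -> R -> {poly R}) : (forall i, poly_strict_diffable (F i)) ->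
  poly_strict_diffable (fun y t => \sum_(i <- s | Q i) F i y t).
Proof.
move=> h j; apply: (@strict_diffable_eq
  (fun y t => \sum_(i <- s | Q i) (F i y t)`_j)).
  by move=> y t; rewrite coef_sum.
by apply: strict_diffable_sum => i; apply: h.
Qed.

Lemma poly_strict_diffable_prod (I : Type) (s : seq I)
    (F : I -> V -> R -> {poly R}) : (forall i, poly_strict_diffable (F i)) ->
  poly_strict_diffable (fun y t => \prod_(i <- s) F i y t).
Proof.
move=> h; elim: s => [|a s hs].
  by apply: poly_strict_diffable_eq (poly_strict_diffable_cst 1) => y t; rewrite big_nil.
apply: poly_strict_diffable_eq (poly_strict_diffableM (h a) hs) => y t.
by rewrite big_cons.
Qed.

Lemma poly_strict_diffable_det n (F : V -> R -> 'M[{poly R}]_n) :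
  (forall i j, poly_strict_diffable (fun y t => F y t i j)) ->
  poly_strict_diffable (fun y t => \det (F y t)).
Proof.
move=> h; apply: poly_strict_diffable_sum => s.
apply: poly_strict_diffableM; first exact: poly_strict_diffable_cst.
exact: poly_strict_diffable_prod.
Qed.

Lemma poly_strict_diffable_char_poly_mx n (F : V -> R -> 'M[R]_n) :
  (forall i j, strict_diffable (fun y t => F y t i j)) ->
  forall i j, poly_strict_diffable (fun y t => char_poly_mx (F y t) i j).
Proof.
move=> h i j.
apply: (@poly_strict_diffable_eq
  (fun y t => ('X *+ (i == j)) + (-1)%:P * (F y t i j)%:P)).
  by move=> y t; rewrite !mxE polyCN mulN1r.
apply: poly_strict_diffableD; first exact: poly_strict_diffable_cst.
apply: poly_strict_diffableM; first exact: poly_strict_diffable_cst.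
exact: poly_strict_diffableC.
Qed.

(** The polynomials obeying this chain rule include constants and indeterminates and are closed
    under sums and products. It translates the formal derivatives in [char_jacobian] into strict
    differentials. *)
Lemma strict_diff_meval m (p : {mpoly R[m]}) (x : 'I_m -> V -> R -> R)
    (dx : 'I_m -> V -> R) :
  (forall l, strict_diff (x l) (dx l)) ->
  strict_diff (fun y t => p.@[fun l => x l y t])
    (fun y => \sum_l (mderiv l p).@[fun l => x l 0 0] * dx l y).
Proof.
move=> h.
pose S q := strict_diff (fun y t => q.@[fun l => x l y t])
    (fun y => \sum_l (mderiv l q).@[fun l => x l 0 0] * dx l y).
have SC c : S c%:MP_[m].
  apply: strict_diff_eq (strict_diff_cst c) => [y t|y]; first by rewrite mevalC.
  by rewrite big1 // => l _; rewrite mderivC meval0 mul0r.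
have SD q q' : S q -> S q' -> S (q + q').
  move=> hq hq'; apply: strict_diff_eq (strict_diffD hq hq') => [y t|y].
    by rewrite mevalD.
  by rewrite -big_split; apply: eq_bigr => l _; rewrite mderivD mevalD mulrDl.
have SM q q' : S q -> S q' -> S (q * q').
  move=> hq hq'; apply: strict_diff_eq (strict_diffM hq hq') => [y t|y].
    by rewrite mevalM.
  rewrite !mulr_sumr -big_split; apply: eq_bigr => l _ /=.
  by rewrite mderivM mevalD !mevalM; ring.
have S1 : S 1 by rewrite -mpolyC1; apply: SC.
have SX i : S 'X_i.
  apply: strict_diff_eq (h i) => [y t|y]; first by rewrite mevalXU.
  rewrite (bigD1 i) //= big1 => [|l li].
    have UU : (U_(i) - U_(i))%MM = 0%MM by apply/mnmP => j; rewrite mnmBE mnm0E subnn.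
    by rewrite mderivX mnm1E eqxx UU mpolyX0 scale1r -mpolyC1 mevalC mul1r addr0.
  by rewrite mderivX mnm1E eq_sym (negbTE li) scale0r meval0 mul0r.
have SXn i d : S (('X_i : {mpoly R[m]}) ^+ d).
  by elim: d => [|d hd]; rewrite ?expr0 // exprS; apply: SM.
have Sprod q (s : seq 'I_m) : (forall i, S (q i)) -> S (\prod_(i <- s) q i).
  move=> hq; elim: s => [|a s hs]; first by rewrite big_nil.
  by rewrite big_cons; apply: SM.
elim/mpolyind: p => [|c mm p _ _ hp]; first by rewrite -mpolyC0; apply: SC.
apply: SD => //; rewrite -mul_mpolyC; apply: SM; first exact: SC.
rewrite mpolyXE_id; apply: Sprod => i.
exact: SXn.
Qed.

End StrictDifferentiability.

(** * A quantitative implicit function theorem in the max norm *)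

Section ImplicitFunction.
Variable R : realType.

(* Lets HB see that row vectors form a complete normed module. *)
HB.instance Definition _ N := Uniform_isComplete.Build 'rV[R]_N cauchy_cvg.

Lemma ler_mx_norm m n (x : 'M[R]_(m, n)) i j : `|x i j| <= `|x|.
Proof.
rewrite [leRHS]/Num.Def.normr /= mx_normrE; apply/bigmax_geP; right => /=.
by exists (i, j).
Qed.

Lemma mx_norm_le m n (x : 'M[R]_(m, n)) c :
  0 <= c -> (forall i j, `|x i j| <= c) -> `|x| <= c.
Proof.
move=> c0 h; rewrite [leLHS]/Num.Def.normr /= mx_normrE.
by apply/bigmax_leP; split => // -[i j] _; apply: h.
Qed.

Lemma mulmx_norm_bound m n (M : 'M[R]_(m, n)) :
  exists2 c, 0 <= c & forall v : 'rV_m, `|v *m M| <= c * `|v|.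
Proof.
exists (\sum_i \sum_j `|M i j|).
  by apply: sumr_ge0 => i _; apply: sumr_ge0 => j _.
move=> v; apply: mx_norm_le => [|i j].
  by rewrite mulr_ge0 //; apply: sumr_ge0 => i _; apply: sumr_ge0 => j _.
rewrite mxE (le_trans (ler_norm_sum _ _ _)) // mulr_suml; apply: ler_sum => l _.
rewrite normrM mulrC ler_pM ?ler_mx_norm //.
by rewrite (bigD1 j) //= lerDl sumr_ge0.
Qed.

Lemma strict_diff_coord N (j : 'I_N) :
  strict_diff (fun (y : 'rV[R]_N) _ => y 0 j) (fun y => y 0 j).
Proof.
apply: strict_diff_linear => [v w|a v|]; rewrite ?mxE //.
by exists 1 => // v; rewrite mul1r ler_mx_norm.
Qed.

(** The minimum of the radii works, since [Q] passes to smaller ones; this treats all coordinates or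
    all matrix entries at once. *)
Lemma finite_radius (I : finType) (Q : I -> R -> Prop) :
  (forall i, exists2 r, 0 < r & Q i r) ->
  (forall i r s, s <= r -> Q i r -> Q i s) ->
  exists2 r, 0 < r & forall i, Q i r.
Proof.
move=> h hle.
suff [r r0 hr] : exists2 r, 0 < r & forall i, i \in enum I -> Q i r.
  by exists r => // i; apply: hr; rewrite mem_enum.
elim: (enum I) => [|a s [r r0 hr]]; first by exists 1.
have [r' r0' hr'] := h a; exists (Num.min r r'); first by rewrite lt_min r0.
move=> i; rewrite inE => /orP[/eqP->|/hr h'].
  by apply: hle hr'; rewrite ge_min lexx orbT.
by apply: hle h'; rewrite ge_min lexx.
Qed.

(* The equation [H y t = 0] is the fixed point equation of the simplified
   Newton map [y |-> y - H y t J^-1], a contraction near 0. *)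
Lemma implicit_function N (H : 'rV[R]_N -> R -> 'rV[R]_N) (J : 'M[R]_N) :
  J \in unitmx ->
  (forall j, strict_diff (fun y t => H y t 0 j) (fun y => (y *m J) 0 j)) ->
  H 0 0 = 0 ->
  forall rho, 0 < rho -> exists2 r, 0 < r &
    forall t, `|t| <= r -> exists2 y, `|y| <= rho & H y t = 0.
Proof.
move=> Ju Hd H0 rho rho0.
have [c c0 hc] := mulmx_norm_bound (invmx J).
have c1 : 0 < 2 * (c + 1) by rewrite mulr_gt0 // ltr_wpDl.
(* With [c] a bound for multiplication by [invmx J], this makes [c * e] at most 1/2, the contraction
   constant. *)
pose e := (2 * (c + 1))^-1.
have e0 : 0 < e by rewrite invr_gt0.
have ce : c * e <= 1 / 2.
  rewrite /e ler_pdivrMr //; lra.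
have [r1 r10 hr1] : exists2 r, 0 < r & forall j y y' t,
    `|y| <= r -> `|y'| <= r -> `|t| <= r ->
    `|H y t 0 j - H y' t 0 j - ((y - y') *m J) 0 j| <= e * `|y - y'|.
  apply: (finite_radius (Q := fun j r => forall y y' t,
    `|y| <= r -> `|y'| <= r -> `|t| <= r ->
    `|H y t 0 j - H y' t 0 j - ((y - y') *m J) 0 j| <= e * `|y - y'|)).
    by move=> j; have [_ _ _ /(_ _ e0)] := Hd j.
  by move=> j r s sr h y y' t ys y's ts; apply: h; apply: le_trans sr.
pose rho' := Num.min rho r1.
have rho'0 : 0 < rho' by rewrite lt_min rho0.
(* Bounding [H 0 t] by [e * rho'] moves the centre by at most [rho' / 2]; the contraction adds at
   most [rho' / 2], so the ball of radius [rho'] is mapped into itself. *)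
have e'0 : 0 < e * rho' by rewrite mulr_gt0.
have [r2 r20 hr2] : exists2 r, 0 < r & forall j t, `|t| <= r ->
    `|H 0 t 0 j| <= e * rho'.
  apply: (finite_radius (Q := fun j r => forall t, `|t| <= r ->
    `|H 0 t 0 j| <= e * rho')).
    move=> j; have [_ _ /(_ _ e'0)[r r0 hr] _] := Hd j; exists r => // t tr.
    by have := hr 0 t; rewrite H0 mxE subr0 normr0; apply => //; rewrite ltW.
  by move=> j r s sr h t ts; apply: h; apply: le_trans sr.
exists (Num.min r1 r2); first by rewrite lt_min r10.
move=> t; rewrite le_min => /andP[t1 t2].
pose F y := y - H y t *m invmx J.
have FB y y' : `|y| <= rho' -> `|y'| <= rho' ->
    `|F y - F y'| <= 1 / 2 * `|y - y'|.
  rewrite !le_min => /andP[_ yr] /andP[_ y'r].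
  have -> : F y - F y' = ((y - y') *m J - (H y t - H y' t)) *m invmx J.
    by rewrite [RHS]mulmxBl mulmxK // mulmxBl /F !opprD addrACA.
  apply: le_trans (hc _) _.
  apply: (@le_trans _ _ (c * (e * `|y - y'|))); last by rewrite mulrA ler_wpM2r.
  apply: ler_wpM2l => //; apply: mx_norm_le; first by rewrite mulr_ge0 // ltW.
  move=> i j; rewrite ord1; have := hr1 j y y' t yr y'r t1.
  by move: (_ *m J) => M; rewrite !mxE [`|M 0 j - _|]distrC.
have F0 : `|F 0| <= 1 / 2 * rho'.
  rewrite /F sub0r normrN; apply: le_trans (hc _) _.
  apply: (@le_trans _ _ (c * (e * rho'))); last by rewrite mulrA ler_wpM2r // ltW.
  apply: ler_wpM2l => //; apply: mx_norm_le; first by rewrite ltW.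
  by move=> i j; rewrite ord1; apply: hr2.
pose U := closed_ball_ Num.Def.normr (0 : 'rV[R]_N) rho'.
have UE y : U y = (`|y| <= rho') by rewrite /U /closed_ball_ /= sub0r normrN.
have FU : {homo F : y / U y >-> U y}.
  move=> y; rewrite !UE => yr; rewrite -[F y](subrK (F 0)).
  apply: le_trans (ler_normD _ _) _.
  have := FB y 0 yr; rewrite normr0 subr0 => /(_ (ltW rho'0)) h.
  apply: le_trans (lerD h F0) _; lra.
have ctr : is_contraction (mkfun_fun FU).
  have h2 : 0 <= 1 / 2 :> R by lra.
  exists (NngNum h2); split => /=; first lra.
  by move=> [y y'] /= [Uy Uy']; rewrite /self_sub /=; apply: FB; rewrite -UE.
have [||y Uy yF] := @banach_fixed_point R ('rV[R]_N) _ _ ctr.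
- exact: closed_closed_ball_.
- by exists 0; rewrite UE normr0 ltW.
exists y; first by move: Uy; rewrite UE le_min => /andP[].
(* The fixed point gives [H y t *m invmx J = 0], and multiplying by [J] gives [H y t = 0]. *)
move: yF => /= /eqP; rewrite /mkfun /F -subr_eq0 opprB addrCA subrr addr0 => /eqP h.
by rewrite -(mulmxKV Ju (H y t)) h mul0mx.
Qed.

End ImplicitFunction.

(** * The characteristic polynomial of the extended matrix *)

Section ExtensionDeterminant.

(** A Schur complement with the adjugate in place of the inverse: right multiplication by [T] makes
    the matrix block lower triangular, and [\det T = \det S ^+ n] is nonzero, hence can be
    cancelled. *)
Lemma det_bordered (K : idomainType) n (S : 'M[K]_n) (c : 'cV_n) (r : 'rV_n) t :
  \det S != 0 ->
  \det (block_mx S c r t%:M) = t * \det S - (r *m \adj S *m c) 0 0.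
Proof.
move=> S0; have Sn0 : \det S ^+ n != 0 by rewrite expf_neq0.
apply: (mulIf Sn0).
pose T := block_mx (\adj S) (- (\adj S *m c)) 0 (\det S)%:M.
have detT : \det T = \det S ^+ n.
  by rewrite det_ublock det_scalar1 -det_scalar -mul_adj_mx det_mulmx.
rewrite -{1}detT -det_mulmx mulmx_block !mulmx0 !addr0.
rewrite mulmxN mulmxA mul_mx_adj mul_scalar_mx mul_mx_scalar addNr.
rewrite det_lblock det_scalar mulrC; congr (_ * _).
rewrite mulmxN mulmxA -scalar_mxM addrC [in LHS](mx11_scalar (_ *m _ *m _)) -raddfB /=.
by rewrite det_scalar1.
Qed.

Lemma det_castmx (K : comNzRingType) m n (e : m = n) (M : 'M[K]_m) :
  \det (castmx (e, e) M) = \det M.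
Proof. by case: n / e. Qed.

Lemma det_block_lift (K : comNzRingType) n (N : 'M[K]_n.+1) :
  \det N = \det (block_mx (\matrix_(i, j) N (lift ord_max i) (lift ord_max j))
    (\col_i N (lift ord_max i) ord_max) (\row_j N ord_max (lift ord_max j))
    (N ord_max ord_max)%:M).
Proof.
set Q := block_mx _ _ _ _; have e := addn1 n.
have -> : N = castmx (e, e) Q.
  have eL (i : 'I_n) : cast_ord (esym e) (lift ord_max i) = lshift 1 i.
    by apply: val_inj; rewrite -[RHS](lift_max i).
  have eR : cast_ord (esym e) ord_max = rshift n ord0.
    by apply: val_inj; rewrite /= addn0.
  apply/matrixP => i j; rewrite castmxE /=.
  case: (unliftP ord_max i) => [i'|] ->; case: (unliftP ord_max j) => [j'|] ->;
    by rewrite ?eL ?eR ?block_mxEul ?block_mxEur ?block_mxEdl ?block_mxEdr !mxE ?eqxx.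
exact: det_castmx.
Qed.

Lemma cofactor_eq_row (K : comNzRingType) n (S T : 'M[K]_n) i j :
  (forall k l, k != i -> S k l = T k l) -> cofactor S i j = cofactor T i j.
Proof.
move=> h; rewrite /cofactor; congr (_ * \det _).
by apply/matrixP => k l; rewrite !mxE h // eq_sym neq_lift.
Qed.

Variables (R : realType) (k : pattern_kind) (n : nat) (P : pattern k n).
Variables (u v : 'I_n).
Hypothesis uv : u <> v.
Hypothesis cyc : forall c : seq 'I_n, simple_cycle P c -> u \in c ->
  cycle_uses c u u \/ cycle_uses c u v.

(* A nonzero term of this cofactor together with the arc (u, j) would give a
   cycle through u leaving it neither by the loop nor by (u, v). *)
Lemma cofactor_row_eq0 (X : 'M[R]_n) j :
  (forall i l, X i l != 0 -> darc P i l) -> j != u -> j != v -> X u j != 0 ->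
  cofactor (char_poly_mx X) u j = 0.
Proof.
move=> XP ju jv Xuj; rewrite expand_cofactor big1 // => s /eqP sj.
apply/eqP; rewrite mulf_eq0 signr_eq0 /=; apply/negP => /negP nz.
have {}nz i : u != i -> char_poly_mx X i (s i) != 0.
  by move=> ui; move/prodf_neq0: nz => /(_ i ui).
have s_inj : injective s by apply: perm_inj.
pose c := fingraph.orbit s u.
have uc : u \in c by apply: fingraph.in_orbit.
have cyc_c : fcycle s c by apply: fingraph.cycle_orbit.
have nextc x : x \in c -> next c x = s x by move=> /(next_cycle cyc_c)/eqP.
(* A fixed point among the iterates of [u] would, by injectivity of [s], force [s u = u], whereas
   [s u = j]. So the orbit only meets off-diagonal entries, which are those of [- X]. *)
have moved x : x \in c -> s x != x.
  rewrite -fingraph.fconnect_orbit => /fingraph.iter_findex <-.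
  move: (fingraph.findex _ _ _) => m; apply/eqP; rewrite -iterS iterSr.
  have inj_m : injective (iter m s) by elim: m => [|m IH] a b //= /s_inj /IH.
  by move/inj_m/eqP; rewrite sj (negbTE ju).
have arc x : x \in c -> darc P x (s x).
  move=> xc; apply: XP; have [<-|ux] := eqVneq u x; first by rewrite sj.
  have := nz x ux; rewrite !mxE [x == _]eq_sym (negbTE (moved x xc)) mulr0n sub0r.
  by rewrite oppr_eq0 polyC_eq0.
have sc : simple_cycle P c.
  split; first by move=> c0; rewrite c0 in uc.
  apply/andP; split; last exact: fingraph.orbit_uniq.
  apply: cycle_from_next; first exact: fingraph.orbit_uniq.
  by move=> x xc; rewrite nextc // arc.
have [] := cyc sc uc => -[_]; rewrite nextc // sj => /eqP.
  by rewrite (negbTE ju).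
by rewrite (negbTE jv).
Qed.

(** In the Laplace expansion along row [u], every column other than [u] and [v] has either a zero
    entry or, by the cycle condition, a zero cofactor. *)
Lemma char_poly_expand_row (X : 'M[R]_n) :
  (forall i l, X i l != 0 -> darc P i l) ->
  char_poly X = ('X - (X u u)%:P) * cofactor (char_poly_mx X) u u -
                (X u v)%:P * cofactor (char_poly_mx X) u v.
Proof.
move=> XP; rewrite /char_poly (expand_det_row _ u) (bigD1 u) //= (bigD1 v) /=; last first.
  by rewrite eq_sym; apply/eqP.
rewrite big1 ?addr0 => [|j /andP[ju jv]].
  by rewrite !mxE eqxx (negbTE (introN eqP uv)) mulr0n sub0r mulNr.
have [Xj|/cofactor_row_eq0->//] := eqVneq (X u j) 0; last by rewrite mulr0.
by rewrite !mxE eq_sym (negbTE ju) Xj subrr mul0r.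
Qed.

(** Let [a], [b] be the cofactors at [(u, u)], [(u, v)] and [f] the characteristic polynomial of
    [X]. Deleting the loop turns [f] into [f + x_uu a], and bordering gives
    [(z - x_uu)(f + x_uu a) - p q b]. Substituting [(z - x_uu) a = f + x_uv b] yields the
    formula. *)
Lemma char_poly_triangle_extension (X : 'M[R]_n) (N : 'M[R]_n.+1) (p q : R) :
  (forall i l, X i l != 0 -> darc P i l) ->
  (forall i j, N (lift ord_max i) (lift ord_max j) =
     if (i == u) && (j == u) then 0 else X i j) ->
  N ord_max ord_max = X u u ->
  (forall i, N (lift ord_max i) ord_max = if i == u then p else 0) ->
  (forall j, N ord_max (lift ord_max j) = if j == v then q else 0) ->
  char_poly N = 'X * char_poly X +
    (X u u * X u v - p * q)%:P * cofactor (char_poly_mx X) u v.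
Proof.
move=> XP Nll Nww Nlw Nwl.
pose X' : 'M[R]_n := \matrix_(i, j) if (i == u) && (j == u) then 0 else X i j.
pose c : 'cV[{poly R}]_n := - (p%:P *: delta_mx u 0).
pose r : 'rV[{poly R}]_n := - (q%:P *: delta_mx 0 v).
have -> : char_poly N =
    \det (block_mx (char_poly_mx X') c r ('X - (X u u)%:P)%:M).
  rewrite /char_poly det_block_lift; congr (\det (block_mx _ _ _ _%:M)).
  - apply/matrixP => i j; rewrite !mxE Nll; congr ('X *+ _ - _).
    by rewrite (inj_eq lift_inj).
  - apply/colP => i; rewrite !mxE Nlw eq_sym (negbTE (neq_lift _ _)) mulr0n sub0r.
    by rewrite eqxx andbT; case: (i == u); rewrite ?mulr1 ?mulr0.
  - apply/rowP => i; rewrite !mxE Nwl (negbTE (neq_lift _ _)) mulr0n sub0r.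
    by rewrite eqxx /=; case: (i == v); rewrite ?mulr1 ?mulr0.
  - by rewrite !mxE eqxx Nww.
rewrite det_bordered; last by rewrite monic_neq0 // char_poly_monic.
(* [X'] and [X] differ only in row [u], which these cofactors do not see. *)
have cofE j : cofactor (char_poly_mx X') u j = cofactor (char_poly_mx X) u j.
  by apply: cofactor_eq_row => i l iu; rewrite !mxE (negbTE iu).
have -> : \det (char_poly_mx X') =
    char_poly X + (X u u)%:P * cofactor (char_poly_mx X) u u.
  rewrite /char_poly (expand_det_row _ u) (expand_det_row (char_poly_mx X) u).
  rewrite (bigD1 u) //= [X in _ = X + _](bigD1 u) //= cofE addrAC; congr (_ + _).
    by rewrite !mxE !eqxx /=; ring.
  by apply: eq_bigr => j ju; rewrite cofE !mxE eqxx (negbTE ju).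
have -> : (r *m \adj (char_poly_mx X') *m c) 0 0 =
    (p * q)%:P * cofactor (char_poly_mx X) u v.
  rewrite /r /c mulNmx mulmxN mulNmx opprK -!scalemxAl -scalemxAr -rowE -colE.
  by rewrite !mxE cofE polyCM mulrA [q%:P * _]mulrC.
have := char_poly_expand_row XP.
move: (cofactor _ u u) (cofactor _ u v) (char_poly X) => a b d dE.
rewrite polyCB !polyCM dE; ring.
Qed.

End ExtensionDeterminant.

(** * Composite cycles and cofactors *)

Section CompositeWeight.
Variables (R : realType) (n : nat).

Lemma partition_porbits (T : finType) (s : {perm T}) :
  finset.partition (porbits s) [set: T].
Proof.
apply/and3P; split.
- apply/eqP/setP => x; rewrite inE; apply/bigcupP.
  by exists (porbit s x); rewrite ?imset_f ?porbit_id.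
- apply/finset.trivIsetP => _ _ /imsetP[x _ ->] /imsetP[y _ ->]; apply: contraNT.
  rewrite -setI_eq0 => /set0Pn[z]; rewrite inE -!eq_porbit_mem.
  by move=> /andP[/eqP-> /eqP->].
- apply/imsetP => -[x _ /setP/(_ x)].
  by rewrite porbit_id inE.
Qed.

(** The cycle signs multiply to the sign of [s], because the cycle lengths, each less one, add up to
    [n] minus the number of orbits. *)
Lemma composite_weightE (A : 'M[R]_n) (s : {perm 'I_n}) :
  composite_weight A s = (-1) ^+ s * \prod_i A i (s i).
Proof.
rewrite /composite_weight /cycle_weight big_split /=.
have part := partition_porbits s.
congr (_ * _); last first.
  rewrite -(big_trivIset _ (partition_trivIset part)) /= (cover_partition part).
  by apply: eq_bigl => i; rewrite inE.
rewrite -expr_sum -[LHS]signr_odd; congr (_ ^+ _); apply/eqP.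
have card_n : #|'I_n| = (\sum_(c in porbits s) #|c|.-1 + #|porbits s|)%N.
  rewrite -sum1_card -big_split /= -cardsT (card_partition part).
  apply: eq_bigr => c cs; rewrite addn1 prednK // card_gt0.
  by have /and3P[_ _] := part; apply: contra => /eqP <-.
by rewrite /odd_perm card_n oddD addbK.
Qed.

(** Turns condition (ii) into the nonvanishing of a cofactor: in the Leibniz sum, permutations
    sending [u] to [v] that meet a zero entry contribute nothing. *)
Lemma composite_weight_throughE (A : 'M[R]_n) u v :
  composite_weight_through A u v = A u v * cofactor A u v.
Proof.
rewrite /composite_weight_through expand_cofactor mulr_sumr.
rewrite (bigID (composite_cycle_of A) (fun s : {perm 'I_n} => s u == v)) /=.
rewrite [X in _ + X]big1 => [|s /andP[/eqP su]]; last first.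
  rewrite negb_forall => /existsP[l]; rewrite negbK => /eqP Al.
  have [ul|ul] := eqVneq u l; first by rewrite -su ul Al mul0r.
  by rewrite (bigD1 l) //= Al mul0r !mulr0.
rewrite addr0; apply: eq_big => [s|s /andP[_ /eqP su]]; first by rewrite andbC.
rewrite composite_weightE (bigD1 u) //= su mulrCA; congr (_ * (_ * _)).
by apply: eq_bigl => i; rewrite eq_sym.
Qed.

(** At [z = 0] the matrix [zI - A] becomes [- A]; the sign comes from a minor of order [n - 1]. *)
Lemma cofactor_char_poly_mx_coef0 (A : 'M[R]_n) u v :
  (cofactor (char_poly_mx A) u v)`_0 = (-1) ^+ n.-1 * cofactor A u v.
Proof.
rewrite -horner_coef0 -/(horner_eval 0 _) -cofactor_map_mx.
have -> : map_mx (horner_eval 0) (char_poly_mx A) = - A.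
  apply/matrixP => i j; rewrite !mxE /horner_eval hornerD hornerN hornerC hornerMn.
  by rewrite hornerX mul0rn sub0r.
rewrite /cofactor mulrCA; congr (_ * _); rewrite -detZ; congr (\det _).
by apply/matrixP => i j; rewrite !mxE mulN1r.
Qed.

End CompositeWeight.

(** * Purely imaginary spectra and their perturbations *)

Section RootsAndInertia.
Variable R : realType.
Local Notation rc := (real_complex R).

Lemma eigenvalues_prod n (A : 'M[R]_n) :
  map_poly rc (char_poly A) = \prod_(z <- eigenvalues A) ('X - z%:P).
Proof.
rewrite /eigenvalues; case: closed_field_poly_normal => rs /= ->.
have -> : lead_coef (map_poly rc (char_poly A)) = 1.
  by apply/monicP; rewrite map_monic char_poly_monic.
by rewrite scale1r.
Qed.

Lemma eigenvalues_perm n (A : 'M[R]_n) rs :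
  map_poly rc (char_poly A) = \prod_(z <- rs) ('X - z%:P) ->
  perm_eq (eigenvalues A) rs.
Proof. by rewrite eigenvalues_prod => /prod_XsubC_eq. Qed.

Lemma inertia_roots n (A : 'M[R]_n) rs :
  map_poly rc (char_poly A) = \prod_(z <- rs) ('X - z%:P) ->
  inertia A = (count (fun z => 0 < complex.Re z) rs,
               count (fun z => complex.Re z < 0) rs,
               count (fun z => complex.Re z == 0) rs).
Proof.
move=> /eigenvalues_perm/seq.permP h; rewrite /inertia /refined_inertia !h.
congr (_, _, _); elim: rs {h} => //= z rs <-; rewrite addnACA; congr (_ + _)%N.
by case: eqP => [->|] //=; rewrite eqxx.
Qed.

(** The real quadratic with the conjugate roots [a + ib] and [a - ib]. *)
Definition pair_poly (a b : R) : {poly R} := ('X - a%:P) ^+ 2 + (b ^+ 2)%:P.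

Lemma map_pair_poly (a b : R) : map_poly rc (pair_poly a b) =
  ('X - (Complex a b)%:P) * ('X - (Complex a (- b))%:P).
Proof.
rewrite rmorphD rmorphXn rmorphB /= map_polyX !map_polyC /=.
have -> : Complex a b = rc a + 'i%C * rc b by simpc.
have -> : Complex a (- b) = rc a - 'i%C * rc b by simpc.
have -> : rc (b ^+ 2) = - ('i%C * rc b) ^+ 2.
  by rewrite exprMn sqr_i mulN1r opprK rmorphXn.
move: (rc a) ('i%C * _) => x y; rewrite polyCN polyCB polyCD rmorphXn /=; ring.
Qed.

(** Here [zs] lists the speeds at which real roots leave 0, and an element [(s, b)] of [ps] moves
    the pair of roots [ib], [-ib] horizontally with speed [s]. *)
Definition perturbed_roots (zs : seq R) (ps : seq (R * R)) (t : R) : seq (complex R) :=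
  [seq rc (s * t) | s <- zs] ++
  flatten [seq [:: Complex (x.1 * t) x.2; Complex (x.1 * t) (- x.2)] | x <- ps].

Definition perturbed_poly (zs : seq R) (ps : seq (R * R)) (t : R) : {poly R} :=
  \prod_(s <- zs) ('X - (s * t)%:P) * \prod_(x <- ps) pair_poly (x.1 * t) x.2.

Lemma map_perturbed_poly zs ps t :
  map_poly rc (perturbed_poly zs ps t) = \prod_(z <- perturbed_roots zs ps t) ('X - z%:P).
Proof.
rewrite /perturbed_poly /perturbed_roots rmorphM big_cat /=; congr (_ * _).
  by rewrite map_prod_XsubC big_map.
rewrite rmorph_prod; elim: ps => [|x ps IH]; first by rewrite !big_nil.
by rewrite big_cons /= !big_cons IH map_pair_poly mulrA.
Qed.

Lemma count_perturbed_roots (f : R -> bool) zs ps t :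
  count (fun z => f (complex.Re z)) (perturbed_roots zs ps t) =
  (count (fun s => f (s * t)%R) zs + 2 * count (fun s => f (s * t)%R) (unzip1 ps))%N.
Proof.
rewrite count_cat count_map; congr (_ + _)%N.
by elim: ps => //= x ps ->; lia.
Qed.

Lemma count0_perturbed_roots zs bs t : all (fun b : R => b != 0) bs ->
  count (fun z => z == 0) (perturbed_roots zs [seq (0, b) | b <- bs] t) =
  count (fun s => s * t == 0) zs.
Proof.
move=> bs0; rewrite count_cat count_map -[RHS]addn0; congr (_ + _)%N.
  by apply: eq_count => s /=; rewrite -[0 in LHS]/(rc 0) (inj_eq (fmorph_inj rc)).
elim: bs bs0 => //= b bs IH /andP[b0 /IH ->].
by rewrite !eq_complex /= oppr_eq0 (negbTE b0) !andbF.
Qed.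

Lemma monic_perturbed_poly zs ps t : perturbed_poly zs ps t \is monic.
Proof.
rewrite monicMl ?monic_prod_XsubC //; apply: monic_prod => x _.
rewrite monicE lead_coefDl; first by rewrite -monicE monic_exp ?monicXsubC.
by rewrite size_exp_XsubC (leq_ltn_trans (size_polyC_leq1 _)).
Qed.

Lemma size_perturbed_poly zs ps t :
  size (perturbed_poly zs ps t) = (size zs + 2 * size ps).+1.
Proof.
rewrite -(size_map_poly rc) map_perturbed_poly size_prod_XsubC size_cat size_map.
by congr (_ + _).+1; elim: ps => //= x ps ->; lia.
Qed.

Lemma perturbed_poly0 zs ps :
  perturbed_poly zs ps 0 = 'X^(size zs) * \prod_(b <- unzip2 ps) pair_poly 0 b.
Proof.
rewrite /perturbed_poly; congr (_ * _).
  by elim: zs => [|s zs IH]; rewrite ?big_nil ?big_cons //= IH mulr0 subr0 exprS.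
by rewrite big_map; apply: eq_bigr => x _; rewrite mulr0.
Qed.

(** The remainder [r0 + r1 z] is real and vanishes at [ib]; its real part [r0] and imaginary part
    [r1 b] are then both 0. *)
Lemma dvdp_pair_poly (p : {poly R}) (b : R) : b != 0 ->
  root (map_poly rc p) (Complex 0 b) -> pair_poly 0 b %| p.
Proof.
move=> b0 pz; set d := pair_poly 0 b.
have szd : size d = 3%N.
  by have := size_perturbed_poly [::] [:: (0, b)] 0; rewrite /perturbed_poly big_nil big_seq1 mul1r mulr0.
have dz : root (map_poly rc d) (Complex 0 b).
  by rewrite map_pair_poly rootM root_XsubC eqxx.
have d0 : d != 0 by rewrite -size_poly_eq0 szd.
have rz : root (map_poly rc (p %% d)) (Complex 0 b).
  have -> : p %% d = p - p %/ d * d by rewrite {2}(divp_eq p d) addrAC subrr add0r.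
  by rewrite rootE rmorphB rmorphM hornerD hornerN hornerM (rootP dz) (rootP pz)
    mulr0 subrr.
have szr : (size (p %% d)%R <= 2)%N by have := ltn_modp p d; rewrite d0 szd ltnS.
have szr' : (size (map_poly rc (p %% d)%R) <= 2)%N by rewrite size_map_poly.
move: rz; rewrite rootE (horner_coef_wide _ szr') !big_ord_recl big_ord0 !coef_map /=.
rewrite expr0 expr1 mulr1 addr0 eq_complex /= !mul0r !mulr0 !addr0 !subr0 add0r.
rewrite mulf_eq0 (negbTE b0) orbF => /andP[/eqP r0 /eqP r1].
rewrite /dvdp; apply/eqP/polyP => -[|[|l]]; rewrite coef0 //.
  by rewrite -[LHS]addr0.
by rewrite nth_default // (leq_trans szr).
Qed.

(** Induction on the degree: a root [ib] splits off the factor [z] if [b = 0], and [z^2 + b^2]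
    otherwise. *)
Lemma imaginary_roots_factor (p : {poly R}) : p \is monic ->
  (forall z, root (map_poly rc p) z -> complex.Re z = 0) ->
  exists c (bs : seq R), all (fun b : R => b != 0) bs /\
    p = 'X^c * \prod_(b <- bs) pair_poly 0 b.
Proof.
have [m] := ubnP (size p); elim: m p => // m IH p; rewrite ltnS => pm p_mon rts.
have [p1|p1] := eqVneq (size p) 1%N.
  exists 0%N, [::]; split=> //; rewrite big_nil mulr1 expr0.
  have /size_poly1P[a a0 pa] : size p == 1%N by rewrite p1.
  by move: p_mon; rewrite pa monicE lead_coefC => /eqP->.
have [z pz] : exists z, root (map_poly rc p) z.
  by apply/closed_rootP; rewrite size_map_poly.
have {}rts q d : p = q * d -> forall z, root (map_poly rc q) z -> complex.Re z = 0.
  by move=> pq x qx; apply: rts; rewrite pq rmorphM rootM qx.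
(* The quotient by a nonconstant monic divisor is monic of smaller degree and inherits the condition
   on the roots, so the induction hypothesis applies to it. *)
have step d : d \is monic -> (1 < size d)%N -> d %| p -> exists q c (bs : seq R),
    p = q * d /\ all (fun b : R => b != 0) bs /\ q = 'X^c * \prod_(b <- bs) pair_poly 0 b.
  move=> d_mon d1 /divpK pd; pose q := p %/ d; exists q.
  have q_mon : q \is monic by rewrite -(monicMr _ d_mon) pd.
  have [||c [bs [h1 h2]]] := IH q _ q_mon; last by exists c, bs.
  - apply: leq_trans pm; rewrite -[in ltnRHS]pd size_Mmonic ?monic_neq0 //.
    have : (0 < size q)%N by rewrite size_poly_gt0 monic_neq0.
    by rewrite -/q; move: d1; move: (size q) (size d) => x y; lia.
  - by apply: rts; rewrite -[LHS]pd.
have := rts p 1 (esym (mulr1 p)) z pz; case: z pz => a b pz /= a0.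
rewrite a0 in pz => {a0 a}.
have [b0|b0] := eqVneq b 0.
  have [||q [c [bs [pq [h1 h2]]]]] := step 'X (monicX _).
  - by rewrite size_polyX.
  - rewrite b0 -[Complex 0 0]/(rc 0) fmorph_root in pz.
    by rewrite -['X]subr0 -polyC0 dvdp_XsubCl.
  by exists c.+1, bs; split=> //; rewrite pq h2 exprS -mulrA mulrC.
have [|||q [c [bs [pq [h1 h2]]]]] := step (pair_poly 0 b).
- by have := monic_perturbed_poly [::] [:: (0, b)] 0; rewrite /perturbed_poly big_nil big_seq1 mul1r mulr0.
- by have := size_perturbed_poly [::] [:: (0, b)] 0;
    rewrite /perturbed_poly big_nil big_seq1 mul1r mulr0 => ->.
- exact: dvdp_pair_poly.
exists c, (b :: bs); rewrite /= b0; split=> //.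
by rewrite big_cons pq h2 -mulrA; congr (_ * _); rewrite mulrC.
Qed.

Lemma refined_inertia_imaginary n (A : 'M[R]_n) c1 c2 :
  refined_inertia A = (0, 0, c1, c2)%N ->
  exists bs : seq R, all (fun b : R => b != 0) bs /\
    char_poly A = 'X^c1 * \prod_(b <- bs) pair_poly 0 b.
Proof.
case=> pos neg zer _.
have [|c [bs [h1 h2]]] := imaginary_roots_factor (char_poly_monic A).
  move=> z; rewrite eigenvalues_prod root_prod_XsubC => zr.
  move: pos neg => /eqP; rewrite -leqn0 leqNgt -has_count => /hasPn/(_ z zr) p1.
  move=> /eqP; rewrite -leqn0 leqNgt -has_count => /hasPn/(_ z zr) p2.
  by apply/eqP; rewrite eq_le !leNgt p1 p2.
exists bs; split=> //; rewrite h2; congr ('X^_ * _).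
(* Viewing the factorization as the case of zero speeds lists all eigenvalues; counting the zero
   ones identifies the exponent [c] with [c1]. *)
have e : char_poly A = perturbed_poly (nseq c 0) [seq (0, b) | b <- bs] 0.
  by rewrite perturbed_poly0 size_nseq /unzip2 -map_comp map_id.
have := map_perturbed_poly (nseq c 0) [seq (0, b) | b <- bs] 0.
rewrite -e => /eigenvalues_perm/seq.permP h.
by rewrite -zer h count0_perturbed_roots // count_nseq /= mul0r eqxx mul1n.
Qed.

End RootsAndInertia.

(** * Perturbations reaching every inertia *)

Section Targets.
Variable R : realType.

(** Greedy filling works: rounding [a], [b], [c] down to even numbers loses at most 3 in total, and
    [m >= 3] leaves room for that. *)
Lemma distribute_pairs (m k a b c : nat) : (3 <= m)%N ->
  (a + b + c = m + 2 * k)%N ->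
  exists ka kb kc, [/\ (ka + kb + kc = k)%N, (2 * ka <= a)%N,
    (2 * kb <= b)%N & (2 * kc <= c)%N].
Proof.
move=> m3 abc; pose ka := minn k (a %/ 2); pose kb := minn (k - ka) (b %/ 2).
by exists ka, kb, (k - ka - kb)%N; rewrite /kb /ka; split; lia.
Qed.

Lemma inertia_target (bs : seq R) m (a b c : nat) : (3 <= m)%N ->
  (a + b + c = m + 2 * size bs)%N ->
  exists zs ps, [/\ size zs = m, unzip2 ps = bs &
    forall (t : R) n (M : 'M[R]_n), 0 < t -> char_poly M = perturbed_poly zs ps t ->
      inertia M = (a, b, c)].
Proof.
move=> m3 abc; have [ka [kb [kc [kE ha hb hc]]]] := distribute_pairs m3 abc.
(* Speeds 1, -1 and 0 put a root to the right of, to the left of, or on the imaginary axis; each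
   pair fills two places of its class, and real roots fill the rest. *)
pose sg x y z : seq R := nseq x 1 ++ nseq y (-1) ++ nseq z 0.
have size_sg x y z : size (sg x y z) = (x + y + z)%N.
  by rewrite !size_cat !size_nseq addnA.
have size_ps : size (sg ka kb kc) = size bs by rewrite size_sg.
exists (sg (a - 2 * ka) (b - 2 * kb) (c - 2 * kc))%N, (zip (sg ka kb kc) bs).
split.
- by rewrite size_sg; lia.
- by rewrite unzip2_zip // size_ps.
move=> t n M t0 ME.
have := map_perturbed_poly (sg (a - 2 * ka) (b - 2 * kb) (c - 2 * kc))%N
  (zip (sg ka kb kc) bs) t.
rewrite -ME => /inertia_roots ->.
have cnt f x y z : count f (sg x y z) = (f 1%R * x + f (-1)%R * y + f 0%R * z)%N.
  by rewrite !count_cat !count_nseq addnA.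
rewrite !(count_perturbed_roots (fun x => 0 < x)) !(count_perturbed_roots (fun x => x < 0)).
rewrite !(count_perturbed_roots (fun x => x == 0)) unzip1_zip ?size_ps // !cnt.
rewrite mul1r mul0r mulN1r oppr_gt0 oppr_lt0 oppr_eq0 t0 ltxx eqxx.
rewrite (lt_gtF t0) (gt_eqF t0) !mul1n !mul0n !addn0 !add0n.
by congr (_, _, _); lia.
Qed.

End Targets.

(** * Representatives and stability of pattern entries *)

Section Entries.
Variables (R : realType) (k : pattern_kind).
Implicit Types e : entry k.

(** Normalized so that a nonzero representative is its own inverse. *)
Definition entry_rep : entry k -> R :=
  match k with
  | NonzeroPattern => fun x => if x then 1 else 0
  | SignPattern => fun x =>
      match x with SZero => 0 | SPlus => 1 | SMinus => -1 end
  end.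

Lemma entry_rep_holds e (t : R) : 0 < t -> entry_holds e (t * entry_rep e).
Proof.
rewrite /entry_rep; move=> t0; case: k e => -[] /=.
- by rewrite mulr1 (gt_eqF t0).
- by rewrite mulr0 eqxx.
- by rewrite mulr0.
- by rewrite mulr1.
- by rewrite mulrN1 oppr_lt0.
Qed.

Lemma entry_rep_sqr e : entry_nz e -> entry_rep e * entry_rep e = 1.
Proof. by rewrite /entry_rep; case: k e => -[] //= _; rewrite ?mulr1 ?mulrNN ?mulr1. Qed.

Lemma entry_holds_nz e (x : R) : entry_holds e x -> (x != 0) = entry_nz e.
Proof.
case: k e => -[] /= h.
- by case: (x == 0) h.
- by case: (x == 0) h.
- by rewrite h.
- by rewrite gt_eqF.
- by rewrite lt_eqF.
Qed.

(** Within distance [|x| / 2] of a nonzero [x] the sign does not change. *)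
Lemma entry_holds_open e (x : R) : entry_nz e -> entry_holds e x ->
  exists2 r, 0 < r & forall x', `|x' - x| <= r -> entry_holds e x'.
Proof.
move=> nz h; have x0 : x != 0 by rewrite (entry_holds_nz h).
exists (`|x| / 2); first by rewrite divr_gt0 // normr_gt0.
move=> x'; rewrite ler_distl => /andP[h1 h2].
have [xp|xn] := ltP 0 x.
  rewrite gtr0_norm // in h1 h2; have x'0 : 0 < x' by lra.
  case: k e nz h => -[] //= _; rewrite ?(gt_eqF x'0) //.
  by rewrite ltNge (ltW xp).
have {}xn : x < 0 by rewrite lt_neqAle x0.
rewrite ltr0_norm // in h1 h2; have x'0 : x' < 0 by lra.
case: k e nz h => -[] //= _; rewrite ?(lt_eqF x'0) //.
by rewrite ltNge (ltW xn).
Qed.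

(** With [e], [e'] on the two new arcs and [f], [f'] at [(u, u)], [(u, v)], the signed extension
    condition makes the sign of [x y] times that of [e] equal to [e']. *)
Lemma entry_holds_product e e' f f' (x y : R) : entry_nz e -> entry_nz e' ->
  same_sgn_product e e' f f' -> entry_nz f -> entry_nz f' ->
  entry_holds f x -> entry_holds f' y ->
  entry_holds e' (entry_rep e * (x * y)).
Proof.
rewrite /entry_rep; case: k e e' f f' => /=.
  move=> [] // [] // [] // [] //= _ _ _ _ _ /eqP hx /eqP hy.
  by rewrite mul1r mulf_eq0 hx hy.
by move=> [] // [] // [] // [] //= _ _ _ _ _ hx hy;
  rewrite ?mul1r ?mulN1r ?oppr_gt0 ?oppr_lt0; nra.
Qed.

End Entries.

(** * Controlling the coefficients through the Jacobian *)

Section Parametrization.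
Variables (R : realType) (n : nat) (A : 'M[R]_n).
Hypothesis fullA : full_rank_jacobian A.

Lemma strict_diff_mulmx N m (M : 'M[R]_(N, m)) l :
  strict_diff (fun (y : 'rV[R]_N) _ => (y *m M) 0 l) (fun y => (y *m M) 0 l).
Proof.
apply: strict_diff_linear => [v w|a v|].
- by rewrite mulmxBl mxE [X in _ + X]mxE.
- by rewrite -scalemxAl mxE.
- have [c c0 hc] := mulmx_norm_bound M; exists c => // v.
  exact: le_trans (ler_mx_norm _ _ _) (hc v).
Qed.

(** The nonzero entries of [A] move along a right inverse of the Jacobian, so to first order each
    nonleading coefficient follows its own coordinate. [S] discards the last coordinate, which is
    reserved for the parameter [d] of the new arcs. *)
Lemma full_rank_parametrization :
  exists X : 'rV[R]_n.+1 -> 'M[R]_n,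
  [/\ X 0 = A, forall y i j, X y i j != 0 -> A i j != 0,
      forall i j, strict_diffable (fun y _ => X y i j) &
      forall i : 'I_n, strict_diff (fun y _ => (char_poly (X y))`_(n - i.+1))
                                   (fun y => y 0 (lift ord_max i))].
Proof.
pose S : 'M[R]_(n.+1, n) := \matrix_(i, j) (i == lift ord_max j)%:R.
have yS (y : 'rV[R]_n.+1) i : (y *m S) 0 i = y 0 (lift ord_max i).
  rewrite mxE (bigD1 (lift ord_max i)) //= big1 => [|j ji].
    by rewrite mxE eqxx mulr1 addr0.
  by rewrite mxE (negbTE ji) mulr0.
have free : row_free (char_jacobian A) by rewrite /row_free fullA.
pose K := pinvmx (char_jacobian A).
pose M := S *m K^T.
have MJ : M *m (char_jacobian A)^T = S.
  by rewrite -mulmxA -trmx_mul mulmxVp // trmx1 mulmx1.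
pose pos (l : 'I_#|nz_positions A|) : R := A (nz_position l).1 (nz_position l).2.
pose x l (y : 'rV[R]_n.+1) : R := pos l + (y *m M) 0 l.
have dx l : strict_diff (fun y (_ : R) => x l y) (fun y => (y *m M) 0 l).
  apply: strict_diff_eq (strict_diffD (strict_diff_cst _ (pos l))
    (strict_diff_mulmx M l)) => // y.
  by rewrite add0r.
have x0 : (fun l => x l 0) = pos.
  by apply/funext => l; rewrite /x mul0mx mxE addr0.
have indetE y i j : (indet_mx A i j).@[fun l => x l y] =
    \sum_(l | nz_position l == (i, j)) x l y.
  rewrite mxE raddf_sum /=; apply: eq_bigr => l _; exact: mevalXU.
pose X y := map_mx (meval (fun l => x l y)) (indet_mx A).
exists X; split.
- apply/matrixP => i j; rewrite mxE indetE.
  have [Aij|Aij] := eqVneq (A i j) 0.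
    rewrite big1 // => l /eqP lij; have := enum_valP l.
    by rewrite -/(nz_position l) lij inE /= Aij eqxx.
  have ijP : (i, j) \in nz_positions A by rewrite inE.
  have lE l : (nz_position l == (i, j)) = (l == enum_rank_in ijP (i, j)).
    rewrite /nz_position; apply/eqP/eqP => [le|->].
      by apply: enum_val_inj; rewrite enum_rankK_in.
    by rewrite enum_rankK_in.
  rewrite (eq_bigl _ _ lE) big_pred1_eq -[LHS]/((fun l => x l 0) _) x0 /pos.
  by rewrite /nz_position enum_rankK_in.
- move=> y i j; apply: contraNN => /eqP Aij; rewrite mxE indetE big1 // => l /eqP lij.
  by have := enum_valP l; rewrite -/(nz_position l) lij inE /= Aij eqxx.
- move=> i j; exists (fun y => \sum_l (mderiv l (indet_mx A i j)).@[fun l => x l 0] *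
    (y *m M) 0 l).
  apply: strict_diff_eq (strict_diff_meval (indet_mx A i j) dx) => // y t.
  by rewrite [RHS]mxE.
- move=> i; apply: strict_diff_eq (strict_diff_meval (char_coef A i.+1) dx).
    by move=> y t; rewrite /X -map_char_poly coef_map.
  (* By the chain rule the differential is [y *m M] times the transposed Jacobian, that is
     [y *m S]. *)
  move=> y; rewrite x0 -yS -MJ mulmxA [RHS]mxE; apply: eq_bigr => l _.
  by rewrite !mxE mulrC.
Qed.

End Parametrization.

(** * The extended matrix and its smooth dependence on the data *)

Section TriangleMatrix.
Variables (R : realType) (n : nat) (u v : 'I_n).

Definition triangle_mx (X : 'M[R]_n) (p q : R) : 'M[R]_n.+1 :=
  \matrix_(i, j)
    match unlift ord_max i, unlift ord_max j with
    | Some i', Some j' => if (i' == u) && (j' == u) then 0 else X i' j'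
    | Some i', None => if i' == u then p else 0
    | None, Some j' => if j' == v then q else 0
    | None, None => X u u
    end.

Lemma triangle_mx_strict_diffable (V : normedModType R) (X : V -> R -> 'M[R]_n)
    (p : R) (q : V -> R -> R) :
  (forall i j, strict_diffable (fun y t => X y t i j)) -> strict_diffable q ->
  forall i j, strict_diffable (fun y t => triangle_mx (X y t) p (q y t) i j).
Proof.
move=> dX dq i j.
have D f : strict_diffable f ->
    (forall y t, f y t = triangle_mx (X y t) p (q y t) i j) ->
    strict_diffable (fun y t => triangle_mx (X y t) p (q y t) i j).
  by move=> df e; apply: strict_diffable_eq df.
case ei : (unlift ord_max i) => [i'|]; case ej : (unlift ord_max j) => [j'|].
- case uu : ((i' == u) && (j' == u)).
    by apply: (D _ (strict_diffable_cst _ 0)) => y t; rewrite mxE ei ej uu.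
  by apply: (D _ (dX i' j')) => y t; rewrite mxE ei ej uu.
- by apply: (D _ (strict_diffable_cst _ (if i' == u then p else 0))) => y t;
    rewrite mxE ei ej.
- case jv : (j' == v); first by apply: (D _ dq) => y t; rewrite mxE ei ej jv.
  by apply: (D _ (strict_diffable_cst _ 0)) => y t; rewrite mxE ei ej jv.
- by apply: (D _ (dX u u)) => y t; rewrite mxE ei ej.
Qed.

End TriangleMatrix.

(** * Membership of the extended matrix in the pattern *)

Section PatternOfExtension.
Variables (R : realType) (k : pattern_kind) (n : nat) (P : pattern k n).
Variables (u v : 'I_n) (B : pattern k n.+1).
Hypotheses (BP : kind_triangle_extension P B u v).
Hypotheses (Puv : darc P u v) (Puu : darc P u u).

Lemma triangle_mx_eq0 (X : 'M[R]_n) p q i j :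
  (forall i j, X i j != 0 -> entry_nz (P i j)) ->
  ~~ entry_nz (B i j) -> triangle_mx u v X p q i j = 0.
Proof.
have [[Bll Bww Blw Bwl] _] := BP => XP.
case: (unliftP ord_max i) => [i'|] ->; case: (unliftP ord_max j) => [j'|] ->;
  rewrite mxE ?unlift_none ?liftK.
- rewrite Bll; case: ifP => // _; apply: contraNeq; exact: XP.
- by rewrite -/(darc B _ _) Blw => /negbTE->.
- by rewrite -/(darc B _ _) Bwl => /negbTE->.
- by rewrite Bww -/(darc P _ _) Puu.
Qed.

(** This is the base point [d = 0], where [q = p x_uu x_uv]; the sign condition enters only at the
    arc from the new vertex to [v]. *)
Lemma triangle_mx_holds (A : 'M[R]_n) i j : in_pattern P A ->
  let p := entry_rep R (B (lift ord_max u) ord_max) in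
  entry_nz (B i j) ->
  entry_holds (B i j) (triangle_mx u v A p (p * (A u u * A u v)) i j).
Proof.
have [[Bll Bww Blw Bwl] Bs] := BP => PA p.
have Buw : entry_nz (B (lift ord_max u) ord_max).
  by rewrite -/(darc B _ _) Blw.
have Bwv : entry_nz (B ord_max (lift ord_max v)).
  by rewrite -/(darc B _ _) Bwl.
case: (unliftP ord_max i) => [i'|] ->; case: (unliftP ord_max j) => [j'|] ->;
  rewrite mxE ?unlift_none ?liftK.
- rewrite Bll; case: (_ && _) => [|_]; last exact: PA.
  by case: (k).
- rewrite -/(darc B _ _) Blw => /eqP->; rewrite eqxx -[p]mul1r.
  exact: entry_rep_holds.
- rewrite -/(darc B _ _) Bwl => /eqP->; rewrite eqxx.
  exact: entry_holds_product Buw Bwv Bs Puu Puv (PA _ _) (PA _ _).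
- by rewrite Bww.
Qed.

End PatternOfExtension.

(** * Solving for the perturbed polynomial inside the superpattern *)

Theorem theorem4p2 (R : realType) (k : pattern_kind) (n : nat)
    (P : pattern k n) (A : 'M[R]_n) (c1 c2 : nat) (u v : 'I_n)
    (B : pattern k n.+1) (C : pattern k n.+1) :
  in_pattern P A ->
  refined_inertia A = (0%N, 0%N, c1, c2) ->
  (2 <= c1)%N ->
  full_rank_jacobian A ->
  u <> v ->
  darc P u v ->
  (exists s : {perm 'I_n}, composite_cycle P s /\ s u = v) ->
  darc P u u ->
  (forall c : seq 'I_n, simple_cycle P c -> u \in c ->
     cycle_uses c u u \/ cycle_uses c u v) ->
  composite_weight_through A u v <> 0 ->
  kind_triangle_extension P B u v ->
  superpattern C B ->
  inertially_arbitrary R C.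
Proof.
move=> PA riA c1ge fullA uv Puv _ Puu cyc wt BP CB a b c abc.
have [bs [_ pA]] := refined_inertia_imaginary riA.
have nE : n = (c1 + 2 * size bs)%N.
  have := size_perturbed_poly (nseq c1 0) [seq (0, b) | b <- bs] 0.
  rewrite perturbed_poly0 size_nseq /unzip2 -map_comp map_id -pA size_char_poly size_map.
  by case.
(* The factor [z] gained by the extension raises the number of zero roots to [c1 + 1 >= 3]. *)
have [||zs [ps [szz psE target]]] := @inertia_target R bs c1.+1 a b c.
- by [].
- by rewrite abc {1}nE.
have [X [X0 Xnz Xd Xc]] := full_rank_parametrization fullA.
have XP y i j : X y i j != 0 -> darc P i j.
  by move=> /Xnz; rewrite (entry_holds_nz (PA i j)).
pose p : R := entry_rep R (B (lift ord_max u) ord_max).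
have pp : p * p = 1.
  apply: entry_rep_sqr; have [[_ _ Blw _] _] := BP.
  by rewrite -/(darc B _ _) Blw.
(* Since [p * p = 1], this makes [x_uu x_uv - p q] equal to the last coordinate of [y]. *)
pose q y : R := p * (X y u u * X y u v - y 0 ord_max).
(* Fills the positions outside [B] with entries legal for [C]; scaled by [t > 0] they stay legal,
   and they disappear at [t = 0]. *)
pose E : 'M[R]_n.+1 := \matrix_(i, j)
  if entry_nz (B i j) then 0 else entry_rep R (C i j).
pose Psi (y : 'rV[R]_n.+1) (t : R) := triangle_mx u v (X y) p (q y) + t *: E.
pose h y := cofactor (char_poly_mx (X y)) u v.
have Psi0 y : char_poly (Psi y 0) = 'X * char_poly (X y) + (y 0 ord_max)%:P * h y.
  rewrite /Psi scale0r addr0 /h.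
  rewrite (char_poly_triangle_extension uv cyc (X := X y) (p := p) (q := q y)).
  - congr (_ + _%:P * _); rewrite /q mulrA pp mul1r; ring.
  - exact: XP.
  - by move=> i j; rewrite mxE !liftK.
  - by rewrite mxE unlift_none.
  - by move=> i; rewrite mxE unlift_none liftK.
  - by move=> j; rewrite mxE unlift_none liftK.
have dq : strict_diffable (fun y (_ : R) => q y).
  apply: strict_diffableM; first exact: strict_diffable_cst.
  have [L dL] := strict_diffableM (Xd u u) (Xd u v).
  have dy := strict_diffM (strict_diff_cst _ (-1)) (strict_diff_coord R (@ord_max n)).
  eexists; apply: strict_diff_eq (strict_diffD dL dy) => // y t.
  by rewrite mulN1r.
have dPsi i j : strict_diffable (fun y t => Psi y t i j).
  have [L dL] := triangle_mx_strict_diffable u v p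
    (X := fun y _ => X y) Xd dq i j.
  have dE := strict_diffM (strict_diff_param ('rV[R]_n.+1)) (strict_diff_cst _ (E i j)).
  eexists; apply: strict_diff_eq (strict_diffD dL dE) => // y t.
  by rewrite [RHS]mxE [X in _ = _ + X]mxE.
have dh : poly_strict_diffable (fun y (_ : R) => h y).
  apply: poly_strict_diffableM; first exact: poly_strict_diffable_cst.
  apply: poly_strict_diffable_det => i j.
  have := poly_strict_diffable_char_poly_mx (F := fun y _ => X y) Xd (lift u i) (lift v j).
  by apply: poly_strict_diffable_eq => y t; rewrite [RHS]mxE [RHS]mxE.
have dtarget : poly_strict_diffable (fun (_ : 'rV[R]_n.+1) t => perturbed_poly zs ps t).
  have lin s : poly_strict_diffable (fun (_ : 'rV[R]_n.+1) t => 'X - (s * t)%:P).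
    apply: (@poly_strict_diffable_eq _ _ (fun _ t => 'X + ((- s) * t)%:P)).
      by move=> y t; rewrite mulNr polyCN.
    apply: poly_strict_diffableD; first exact: poly_strict_diffable_cst.
    apply: poly_strict_diffableC; apply: strict_diffableM.
      exact: strict_diffable_cst.
    by exists (fun=> 0); apply: strict_diff_param.
  apply: poly_strict_diffableM; first exact: poly_strict_diffable_prod.
  apply: poly_strict_diffable_prod => x.
  apply: poly_strict_diffableD; last exact: poly_strict_diffable_cst.
  exact: poly_strict_diffableM.
(* Only the coefficients of degree 0 to [n] are compared: both polynomials are monic of degree
   [n + 1]. *)
pose H (y : 'rV[R]_n.+1) (t : R) : 'rV[R]_n.+1 :=
  \row_j (char_poly (Psi y t) - perturbed_poly zs ps t)`_j.
have H0 : H 0 0 = 0.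
  apply/rowP => j; rewrite mxE Psi0 mxE mul0r addr0 X0 perturbed_poly0 psE szz pA.
  by rewrite mulrA -exprS subrr coef0 mxE.
(* Differential of [z f + d h] at the base point: [d] acts through [h 0], and for [j > 0] the
   coefficient of degree [j] also follows coordinate [n - j], which is [rev_ord j]. *)
pose J : 'M[R]_n.+1 := \matrix_(i, j) ((h 0)`_j * (i == ord_max)%:R +
  ((j != 0) && (i == rev_ord j))%:R).
have yJ (y : 'rV[R]_n.+1) j : (y *m J) 0 j = (h 0)`_j * y 0 ord_max +
    (if j == 0 then 0 else y 0 (rev_ord j)).
  have pick i0 (F : 'I_n.+1 -> R) : \sum_i F i * (i == i0)%:R = F i0.
    rewrite (bigD1 i0) //= eqxx mulr1 big1 ?addr0 // => i /negbTE->.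
    by rewrite mulr0.
  transitivity (\sum_i ((h 0)`_j * y 0 i) * (i == ord_max)%:R +
    \sum_i ((j != 0)%:R * y 0 i) * (i == rev_ord j)%:R).
    rewrite mxE -big_split; apply: eq_bigr => i _ /=; rewrite mxE.
    by rewrite -mulnb natrM; ring.
  by rewrite !pick; congr (_ + _); case: (j == 0); rewrite ?mul0r ?mul1r.
have h00 : (h 0)`_0 != 0.
  rewrite /h X0 cofactor_char_poly_mx_coef0 mulf_neq0 ?signr_eq0 //.
  by move: wt; rewrite composite_weight_throughE => /eqP; rewrite mulf_eq0 negb_or => /andP[].
have Ju : J \in unitmx.
  rewrite -row_free_unit; apply: inj_row_free => y yJ0.
  (* The constant coefficient sees only [d], with the nonzero factor [h(0)]; once [d = 0], the other
     coefficients return the remaining coordinates. *)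
  have ymax : y 0 ord_max = 0.
    have /eqP := yJ y 0; rewrite yJ0 mxE eqxx addr0 eq_sym mulf_eq0 (negbTE h00).
    by move/eqP.
  apply/rowP => i; rewrite mxE; have [->//|im] := eqVneq i ord_max.
  have := yJ y (rev_ord i); rewrite yJ0 mxE ymax mulr0 add0r rev_ordK.
  case: eqP => [ri|_ <- //]; case/eqP: im.
  by rewrite -(rev_ordK i) ri; apply: val_inj; rewrite /= subn1.
have dH j : strict_diff (fun y t => H y t 0 j) (fun y => (y *m J) 0 j).
  have [L dL] : strict_diffable (fun y t => H y t 0 j).
    have d1 := poly_strict_diffable_det (poly_strict_diffable_char_poly_mx dPsi).
    have d2 := poly_strict_diffableM
      (poly_strict_diffable_cst ('rV[R]_n.+1) (-1)%:P) dtarget.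
    apply: strict_diffable_eq (poly_strict_diffableD d1 d2 j) => y t.
    by rewrite mxE polyCN mulN1r.
  (* By uniqueness the differential may be computed at [t = 0], where [Psi0] is explicit. *)
  suff dL' : strict_diff (fun y _ => H y 0 0 j) (fun y => (y *m J) 0 j).
    exact: strict_diff_eq (strict_diff_unique dL dL') dL.
  have [Lh dLh] := dh j.
  have d2 := strict_diffM (strict_diff_coord R (@ord_max n)) dLh.
  have d3 := strict_diffD (strict_diff_cst _ (- (perturbed_poly zs ps 0)`_j)) d2.
  have [j0|j0] := eqVneq j 0.
    apply: strict_diff_eq d3 => [y t|y]; last first.
      by rewrite yJ j0 eqxx mxE mul0r !add0r addr0.
    by rewrite mxE coefB Psi0 coefD coefXM coefCM j0 eqxx add0r addrC.
  have jn : (n - j < n)%N.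
    by rewrite ltn_subrL; move: j0 (ltn_ord u); rewrite -val_eqE /= lt0n; lia.
  have d1 := Xc (Ordinal jn).
  apply: strict_diff_eq (strict_diffD d1 d3) => [y t|y].
    have j0' : (nat_of_ord j == 0%N) = false by apply: negbTE.
    (* Multiplication by [z] shifts degrees: the coefficient of degree [j] comes from degree [j - 1]
       of the characteristic polynomial of [X y]. *)
    have jE : (n - (n - j).+1 = j.-1)%N by move/negbT: j0' (ltn_ord j); lia.
    rewrite mxE coefB Psi0 coefD coefXM coefCM j0' /= jE; ring.
  rewrite yJ (negbTE j0) mxE mul0r !add0r addrC; congr (_ + y 0 _).
  by apply: val_inj; rewrite [LHS]lift_max /= subSS.
have [rho rho0 hrho] : exists2 r, 0 < r & forall (ij : 'I_n.+1 * 'I_n.+1)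
    (y : 'rV[R]_n.+1) t, `|y| <= r -> `|t| <= r -> 0 < t ->
    entry_holds (C ij.1 ij.2) (Psi y t ij.1 ij.2).
  apply: (finite_radius (Q := fun (ij : 'I_n.+1 * 'I_n.+1) r => forall
    (y : 'rV[R]_n.+1) t, `|y| <= r -> `|t| <= r -> 0 < t ->
    entry_holds (C ij.1 ij.2) (Psi y t ij.1 ij.2))); last first.
    by move=> ij r s sr hr y t ys ts; apply: hr; apply: le_trans sr.
  (* Outside [B] the entry is exactly [t] times that of [E], legal for every [y]; on [B] the entry
     is legal at the base point and stays so nearby by continuity. *)
  move=> [i j] /=; have [Bij|Bij] := boolP (entry_nz (B i j)); last first.
    exists 1 => // y t _ _ t0; rewrite mxE (triangle_mx_eq0 BP) // ?add0r.
      by rewrite !mxE (negbTE Bij) entry_rep_holds.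
    exact: XP.
  rewrite (CB _ _ Bij).
  have hold0 : entry_holds (B i j) (Psi 0 0 i j).
    have z0 : (0 : 'rV[R]_n.+1) 0 ord_max = 0 by rewrite mxE.
    rewrite /Psi scale0r addr0 /q X0 z0 subr0.
    exact: (triangle_mx_holds BP Puv Puu PA).
  have [r r0 hr] := entry_holds_open Bij hold0.
  have [L [_ _ /(_ r r0)[r' r'0 hr'] _]] := dPsi i j.
  by exists r' => // y t yr tr _; apply: hr; apply: hr'.
have [r r0 hr] := implicit_function Ju dH H0 rho0.
pose t := Num.min r rho.
have t0 : 0 < t by rewrite lt_min r0.
have [|y yrho Hy] := hr t; first by rewrite gtr0_norm // ge_min lexx.
exists (Psi y t); split.
  move=> i j; apply: (hrho (i, j)) => //.
  by rewrite gtr0_norm // ge_min lexx orbT.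
apply: target t0 _; apply/polyP => j.
have sz : size (perturbed_poly zs ps t) = n.+2.
  by rewrite size_perturbed_poly szz -(size_map snd ps) -/(unzip2 ps) psE nE.
(* [H y t = 0] gives the degrees up to [n], and monicity gives degree [n + 1]. *)
have [jn|jn|->] := ltngtP j n.+1.
- have /rowP/(_ (Ordinal jn)) := Hy; rewrite !mxE coefB => /eqP.
  by rewrite subr_eq0 => /eqP.
- by rewrite !nth_default ?sz ?size_char_poly.
- have /monicP := char_poly_monic (Psi y t).
  have /monicP := monic_perturbed_poly zs ps t.
  by rewrite !lead_coefE sz size_char_poly /= => -> ->.
Qed.
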